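(* Let $R$ be a commutative ring with identity, and let $G$ be an abelian group. Then the following are equivalent. (1) Every maximal ideal of $RG$ is an element of $\Phi(\mathfrak{S})$. (2) $R$ is a field of characteristic $p>0$ and $G$ is a $p$-group. (3) $I(R,G)$ is the unique prime ideal of $RG$. (4) Every prime ideal of $RG$ is an element of $\Phi(\mathfrak{S})$.
   Context: All groups are abelian and written multiplicatively, and all rings are commutative with identity. $RG$ is the group ring of $G$ over $R$, and $\mathfrak{S}$ is the set of subgroups of $G$. For a subgroup $N$ of $G$, $I(R,N)$ is the augmentation ideal of $RN$, i.e. the kernel of the $R$-algebra homomorphism $RN\to R$ sending every element of $N$ to $1$ (in particular $I(R,G)$ is the augmentation ideal of $RG$), and $\Phi(N)=I(R,N)RG$ is the ideal of $RG$ generated by $I(R,N)$. $\Phi(\mathfrak{S})=\{\Phi(N)\mid N\in\mathfrak{S}\}$. Groups are not assumed finite: a $p$-group ($p$ a prime number) is a group in which every element has order a power of $p$.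
   Formalization: The equivalence is proved for R nonzero and excluding the case where R is a field of characteristic 0 and G is trivial; in that case (1), (3), (4) hold but (2) fails, and for R = 0 (1), (4) hold vacuously while (2), (3) fail. *)

(* Defs.v *)
From HB Require Import structures.
From mathcomp Require Import all_boot monoid all_algebra finmap.
From mathcomp Require Import boolp classical_sets.
From mathcomp Require Import monalg.

Set Implicit Arguments.
Unset Strict Implicit.
Unset Printing Implicit Defensive.

Import GRing.Theory.

Local Open Scope fset_scope.
Local Open Scope classical_set_scope.
Local Open Scope ring_scope.

(* MathComp has multiplicative groups (groupType) but no multiplicative abelian
   groups; this adds them. *)
HB.mixin Record Group_isAbelian G of monoid.Group G := {
  mulgC : commutative (@monoid.mul G)
}.

#[short(type="abelianGroupType")]
HB.structure Definition AbelianGroup :=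
  { G of monoid.Group G & Group_isAbelian G }.

Section Groups.
Local Open Scope group_scope.

Definition subgroups (G : groupType) : set (set G) :=
  [set N | group_closed [in N]].

(* The library's #[x] is restricted to finite groups. *)
Definition has_order (G : groupType) (x : G) (m : nat) : Prop :=
  [/\ (0 < m)%N, x ^+ m = 1 & forall k, (0 < k < m)%N -> x ^+ k <> 1].

Definition p_group (p : nat) (G : groupType) : Prop :=
  forall x : G, exists n, has_order x (p ^ n)%N.

End Groups.

Arguments subgroups G : clear implicits.

(* The library's {malg R[K]} (finitely supported functions K -> R) is a ring
   only for monoids K without nontrivial units, hence the product is redefined
   on an alias. *)
Definition group_ring (R : nzRingType) (G : groupType) : Type := {malg R[G]}.

HB.instance Definition _ (R : nzRingType) (G : groupType) :=
  GRing.Lmodule.copy (group_ring R G) {malg R[G]}.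

Section GroupRing.
Context (R : nzRingType) (G : groupType).
Local Notation RG := (group_ring R G).
Implicit Types (x y z : RG) (c : R) (g h : G).

Definition gr_of (g : G) : RG := << 1 *g g >>.

Definition gr_one : RG := gr_of 1%g.

Definition gr_mul (x y : RG) : RG :=
  \sum_(g <- msupp x) \sum_(h <- msupp y) << x@_g * y@_h *g (g * h)%g >>.

Lemma gr_mulw (d1 d2 : {fset G}) x y :
    (msupp x `<=` d1)%fset -> (msupp y `<=` d2)%fset ->
  gr_mul x y = \sum_(g <- d1) \sum_(h <- d2) << x@_g * y@_h *g (g * h)%g >>.
Proof.
move=> le_d1 le_d2; rewrite /gr_mul (big_fset_incl _ le_d1) /=.
  apply/eq_bigr=> g _; apply/big_fset_incl => // h _ /mcoeff_outdom ->.
  by rewrite mulr0 monalgU0.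
move=> g _ /mcoeff_outdom xg.
by rewrite big1 => // h _; rewrite xg mul0r monalgU0.
Qed.

Lemma gr_mul0g : left_zero 0 gr_mul.
Proof. by move=> x; rewrite /gr_mul msupp0 big_seq_fset0. Qed.

Lemma gr_mulg0 : right_zero 0 gr_mul.
Proof.
by move=> x; rewrite /gr_mul msupp0 big1 // => g _; rewrite big_seq_fset0.
Qed.

Lemma gr_mulUg c g y :
  gr_mul << c *g g >> y = \sum_(h <- msupp y) << c * y@_h *g (g * h)%g >>.
Proof.
rewrite (gr_mulw msuppU_le (fsubset_refl _)) big_seq_fset1.
by apply/eq_bigr => h _; rewrite mcoeffUU.
Qed.

Lemma gr_mulgU c h x :
  gr_mul x << c *g h >> = \sum_(g <- msupp x) << x@_g * c *g (g * h)%g >>.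
Proof.
rewrite (gr_mulw (fsubset_refl _) msuppU_le).
by apply/eq_bigr=> g _; rewrite big_seq_fset1 mcoeffUU.
Qed.

Lemma gr_mulUU c d g h :
  gr_mul << c *g g >> << d *g h >> = << c * d *g (g * h)%g >>.
Proof. by rewrite (gr_mulw msuppU_le msuppU_le) !big_seq_fset1 !mcoeffUU. Qed.

Lemma gr_mulEl x y :
  gr_mul x y = \sum_(g <- msupp x) gr_mul << x@_g *g g >> y.
Proof. by apply/eq_bigr=> g _; rewrite gr_mulUg. Qed.

Lemma gr_mulEr x y :
  gr_mul x y = \sum_(h <- msupp y) gr_mul x << y@_h *g h >>.
Proof.
by rewrite [LHS]exchange_big; apply/eq_bigr=> h _; rewrite gr_mulgU.
Qed.

Lemma gr_mul1g : left_id gr_one gr_mul.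
Proof.
move=> x; rewrite gr_mulUg [RHS]monalgE.
by apply/eq_bigr=> g _; rewrite mul1r mul1g.
Qed.

Lemma gr_mulg1 : right_id gr_one gr_mul.
Proof.
move=> x; rewrite gr_mulgU [RHS]monalgE.
by apply/eq_bigr=> g _; rewrite mulr1 mulg1.
Qed.

Lemma gr_mulgDl : left_distributive gr_mul +%R.
Proof.
move=> x y z.
rewrite (@gr_mulw (msupp x `|` msupp y)%fset (msupp z) (x + y)) //;
  last exact: msuppD_le.
rewrite (@gr_mulw (msupp x `|` msupp y)%fset (msupp z) x) ?fsubsetUl//.
rewrite (@gr_mulw (msupp x `|` msupp y)%fset (msupp z) y) ?fsubsetUr//.
rewrite -big_split /=; apply/eq_bigr=> g _.
rewrite -big_split /=; apply/eq_bigr=> h _.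
by rewrite mcoeffD mulrDl monalgUD.
Qed.

Lemma gr_mulgDr : right_distributive gr_mul +%R.
Proof.
move=> z x y.
rewrite (@gr_mulw (msupp z) (msupp x `|` msupp y)%fset z (x + y)) //;
  last exact: msuppD_le.
rewrite (@gr_mulw (msupp z) (msupp x `|` msupp y)%fset z x) ?fsubsetUl//.
rewrite (@gr_mulw (msupp z) (msupp x `|` msupp y)%fset z y) ?fsubsetUr//.
rewrite -big_split /=; apply/eq_bigr=> g _.
rewrite -big_split /=; apply/eq_bigr=> h _.
by rewrite mcoeffD mulrDr monalgUD.
Qed.

Lemma gr_mulA : associative gr_mul.
Proof.
move=> x y z.
rewrite [RHS](big_morph (gr_mul^~ _) (fun _ _ => gr_mulgDl _ _ _) (gr_mul0g _)).
rewrite gr_mulEl; apply/eq_bigr=> g _.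
rewrite [LHS](big_morph (gr_mul _) (fun _ _ => gr_mulgDr _ _ _) (gr_mulg0 _)).
rewrite [RHS](big_morph (gr_mul^~ _) (fun _ _ => gr_mulgDl _ _ _) (gr_mul0g _)).
apply/eq_bigr=> h _.
rewrite [LHS](big_morph (gr_mul _) (fun _ _ => gr_mulgDr _ _ _) (gr_mulg0 _)).
by rewrite gr_mulEr; apply/eq_bigr=> k _; rewrite !gr_mulUU mulrA mulgA.
Qed.

Lemma gr_one_neq0 : gr_one != 0.
Proof.
by apply/eqP/malgP=> /(_ 1%g) /eqP; rewrite mcoeff0 mcoeffUU oner_eq0.
Qed.

HB.instance Definition _ := GRing.Zmodule_isNzRing.Build (group_ring R G)
  gr_mulA gr_mul1g gr_mulg1 gr_mulgDl gr_mulgDr gr_one_neq0.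

Lemma gr_scaleAl c x y : c *: (x * y) = (c *: x) * y.
Proof.
have Z z : c *: z = gr_mul << c *g 1%g >> z.
  rewrite gr_mulUg; apply: eq_bigr => g _; by rewrite mul1g.
by rewrite !Z; apply: gr_mulA.
Qed.

HB.instance Definition _ :=
  GRing.Lmodule_isLalgebra.Build R (group_ring R G) gr_scaleAl.

Definition aug (x : RG) : R := \sum_(g <- msupp x) x@_g.

End GroupRing.

Section CommutativeGroupRing.
Context (R : comNzRingType) (G : abelianGroupType).
Local Notation RG := (group_ring R G).

Lemma gr_mulC : commutative (@GRing.mul RG).
Proof.
move=> x y; rewrite /GRing.mul /= /gr_mul exchange_big /=.
apply/eq_bigr=> h _; apply/eq_bigr=> g _.
by rewrite mulrC mulgC.
Qed.

HB.instance Definition _ :=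
  GRing.PzRing_hasCommutativeMul.Build (group_ring R G) gr_mulC.

HB.instance Definition _ :=
  GRing.Lalgebra_isComAlgebra.Build R (group_ring R G).

Lemma augw (d : {fset G}) (x : RG) :
  (msupp x `<=` d)%fset -> aug x = \sum_(g <- d) x@_g.
Proof. by move=> le_d; apply: big_fset_incl => // g _ /mcoeff_outdom ->. Qed.

Lemma aug_of (g : G) : aug (gr_of R g) = 1.
Proof. by rewrite (augw msuppU_le) big_seq_fset1 mcoeffUU. Qed.

Lemma augU (c : R) (g : G) : aug (<< c *g g >> : RG) = c.
Proof. by rewrite (augw msuppU_le) big_seq_fset1 mcoeffUU. Qed.

Lemma aug_is_zmod_morphism : zmod_morphism (@aug R G).
Proof.
move=> x y; rewrite (augw (msuppB_le x y)).
rewrite (augw (fsubsetUl _ (msupp y))) (augw (fsubsetUr (msupp x) _)) -sumrB.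
by apply: eq_bigr => g _; rewrite mcoeffB.
Qed.

HB.instance Definition _ :=
  GRing.isZmodMorphism.Build RG R (@aug R G) aug_is_zmod_morphism.

Lemma aug_is_monoid_morphism : monoid_morphism (@aug R G).
Proof.
split=> [|x y]; first exact: aug_of.
rewrite {1}/GRing.mul /= /gr_mul raddf_sum /= {2}/aug mulr_suml.
apply: eq_bigr => g _; rewrite raddf_sum /= /aug mulr_sumr.
by apply: eq_bigr => h _; apply: augU.
Qed.

HB.instance Definition _ :=
  GRing.isMonoidMorphism.Build RG R (@aug R G) aug_is_monoid_morphism.

Lemma aug_is_scalable : scalable_for *%R (@aug R G).
Proof.
move=> c x; have le_cx : (msupp (c *: x : RG) `<=` msupp x)%fset.
  apply/fsubsetP => g; rewrite -!mcoeff_neq0 mcoeffZ.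
  by apply: contra_neq => ->; rewrite mulr0.
rewrite (augw le_cx) /aug mulr_sumr.
by apply: eq_bigr => g _; rewrite mcoeffZ.
Qed.

HB.instance Definition _ :=
  GRing.isScalable.Build R RG R *%R (@aug R G) aug_is_scalable.

End CommutativeGroupRing.

Section Ideals.
Variable A : comNzRingType.
Implicit Types I J M P : set A.

(* idealr_closed includes properness, 1 \notin P. *)
Definition prime_ideal P : Prop :=
  idealr_closed [in P] /\ prime_idealr_closed [in P].

Definition maximal_ideal M : Prop :=
  idealr_closed [in M] /\
  forall J, idealr_closed [in J] -> M `<=` J -> J = M.

(* Possibly improper ideals. *)
Definition ideal I : Prop :=
  [/\ I 0, forall x y, I x -> I y -> I (x + y) & forall a x, I x -> I (a * x)].

Definition ideal_generated (S : set A) : set A := smallest ideal S.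

End Ideals.

Section Phi.
Variables (R : comNzRingType) (G : abelianGroupType).
Local Notation RG := (group_ring R G).

(* R N, viewed inside R G. *)
Definition subgroup_ring (N : set G) : set RG :=
  [set x | forall g, g \in msupp x -> N g].

Definition aug_ideal (N : set G) : set RG :=
  subgroup_ring N `&` [set x | aug x = 0].

Definition Phi (N : set G) : set RG := ideal_generated (aug_ideal N).

End Phi.

Arguments aug_ideal R {G} N.
Arguments Phi R {G} N.

Definition is_field (R : comNzRingType) : Prop :=
  forall x : R, x != 0 -> exists y, y * x = 1.

(* Main.v *)
Require Import Defs.
From mathcomp Require Import all_boot monoid all_algebra finmap.
From mathcomp Require Import boolp classical_sets.
From mathcomp Require Import monalg.

Import GRing.Theory.

(** The augmentation ideal I(R,G) is the kernel of [aug : RG -> R], and it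
    contains every Phi(N), since each I(R,N) consists of elements of
    augmentation 0.

    (1) => (2).  An element x with [aug x <> 0] lies in no Phi(N), hence in no
    maximal ideal, hence is a unit ([maximal_Phi_unit_aug]).  Applied to the
    constants this makes R a field.  Applied to s = 1 + g + ... + g^(n-1), whose
    augmentation is n, it turns g^n - 1 = (g - 1) s into g - 1 = y (g^n - 1)
    as soon as n is nonzero in R.  Now the sum of the coefficients on the
    subgroup <g^n> is a linear functional that vanishes on the multiples of
    g^n - 1, so it vanishes on g - 1, and g must lie in <g^n>
    ([unit_aug_generator]).  This one fact gives the group side of (2).  With
    n = 2 or 3, whichever is nonzero in R, it shows that g has finite order;
    if moreover g^m = 1 with m nonzero in R, then g lies in <g^m> = 1.  In
    characteristic 0 this forces G to be trivial, the excluded case; in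
    characteristic p, write an exponent n > 0 with g^n = 1 as m p^a with m prime
    to p, and apply it to g^(p^a), whose m-th power is 1.

    (2) => (3).  In characteristic p, (g - 1)^(p^n) = g^(p^n) - 1 is 0 for n
    large, so a prime ideal contains every g - 1.  These elements span I(R,G)
    over R, and RG/I(R,G) = R is a field, so I(R,G) is itself prime and no
    larger proper ideal exists ([prime_aug_ideal], [prime_ideal_p_group]).

    (3) => (4) holds since I(R,G) = Phi(G), and (4) => (1) since maximal ideals
    are prime. *)

Local Open Scope classical_set_scope.
Local Open Scope ring_scope.

(** * Maximal and prime ideals *)

Section MaximalIdeals.
Variable A : comNzRingType.
Implicit Types (M I : set A) (x y u v a : A).

Lemma idealr_closedP I : idealr_closed [in I] <->
  [/\ I 0, ~ I 1 & forall a u v, I u -> I v -> I (a * u + v)].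
Proof.
split=> -[I0 I1 IL]; split.
- exact: set_mem I0.
- by move=> /mem_set J1; rewrite J1 in I1.
- by move=> a u v Iu Iv; apply/set_mem/IL; apply: mem_set.
- exact: mem_set.
- by apply/negP => /set_mem.
- by move=> a u v /set_mem Iu /set_mem Iv; apply/mem_set/IL.
Qed.

(** Zorn's lemma on the proper ideals containing x.  The union of the empty
    chain is empty, so the empty set is admitted as well; it is never maximal
    because x is not a unit. *)
Lemma exists_maximal_ideal x :
  (forall y, y * x <> 1) -> exists2 M, maximal_ideal M & M x.
Proof.
move=> nux.
pose P I := [/\ ~ I 1, forall a u v, I u -> I v -> I (a * u + v)
               & I !=set0 -> I x].
have [F FP Ftot|M [[M1 ML Mx] Mmax]] := @Zorn_bigcup A P.
  split.
  - by case=> I /FP[].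
  - move=> a u v [I FI Iu] [J FJ Jv].
    have [IJ|JI] := Ftot _ _ FI FJ.
      by have [_ JL _] := FP _ FJ; exists J => //; apply: JL => //; apply: IJ.
    by have [_ IL _] := FP _ FI; exists I => //; apply: IL => //; apply: JI.
  - case=> y [I FI Iy]; exists I => //.
    by have [_ _] := FP _ FI; apply; exists y.
have {Mx} Mx : M x.
  (* Otherwise M is empty, hence smaller than the principal ideal of x. *)
  apply: contrapT => nMx.
  have M0 y : ~ M y by move=> My; apply/nMx/Mx; exists y.
  apply: (Mmax [set y | exists a, y = a * x]).
    split; first by move=> y /M0.
    by move/(_ (1 * x)) => sub; apply/(M0 (1 * x))/sub; exists 1.
  split.
  - by case=> a /esym/nux.
  - by move=> a _ _ [b ->] [c ->]; exists (a * b + c); rewrite mulrDl mulrA.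
  - by move=> _; exists 1; rewrite mul1r.
exists M => //; split.
  by apply/idealr_closedP; split=> //; rewrite -(addNr x) -mulN1r; apply: ML.
move=> J /idealr_closedP[J0 J1 JL] MJ; apply: contrapT => nJM.
apply: (Mmax J).
  split=> // JM; apply: nJM.
  by apply/seteqP; split.
by split=> // _; apply: MJ.
Qed.

Lemma maximal_ideal_prime M : maximal_ideal M -> prime_ideal M.
Proof.
move=> [Mid Mmax]; have [M0 M1 ML] := (idealr_closedP M).1 Mid.
split=> // x y /set_mem Mxy.
have [Mx|nMx] := pselect (M x); first by rewrite (mem_set Mx).
apply/orP; right; apply/mem_set.
pose J := [set z | exists m a, M m /\ z = m + a * x].
have JL a u v : J u -> J v -> J (a * u + v).
  move=> [m [b [Mm ->]]] [n [c [Mn ->]]].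
  exists (a * m + n), (a * b + c); split; first exact: ML.
  by rewrite mulrDr mulrDl addrACA mulrA.
have MJ : M `<=` J by move=> m Mm; exists m, 0; rewrite mul0r addr0.
have [[m [a [Mm e]]]|J1] := pselect (J 1).
  rewrite -[y]mul1r e mulrDl [m * y]mulrC; apply: (ML y m) => //.
  by rewrite -mulrA -[_ * _]addr0; apply: ML.
case: nMx; rewrite -(Mmax J) //; last by apply/idealr_closedP; split=> //; apply: MJ.
by exists 0, 1; rewrite mul1r add0r.
Qed.

Lemma prime_ideal_exp M x n : prime_ideal M -> M (x ^+ n) -> M x.
Proof.
move=> [/idealr_closedP[_ M1 _] Mpr]; elim: n => [/M1//|n IHn].
by rewrite exprS => /mem_set/Mpr/orP[] /set_mem.
Qed.

End MaximalIdeals.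

(** * Elements of the group ring and the augmentation ideal *)

Section GroupRing.
Context (R : comNzRingType) (G : abelianGroupType).
Local Notation RG := (group_ring R G).
Implicit Types (x y : RG) (g h k : G) (N : set G).

Lemma gr_ofM g h : gr_of R (g * h)%g = gr_of R g * gr_of R h.
Proof. by rewrite /GRing.mul /= /gr_of gr_mulUU mulr1. Qed.

Lemma gr_ofX g n : gr_of R (g ^+ n)%g = gr_of R g ^+ n.
Proof.
by elim: n => [|n IHn] //; rewrite monoid.expgS gr_ofM IHn exprS.
Qed.

Lemma gr_sumE x : x = \sum_(g <- msupp x) x@_g *: gr_of R g.
Proof.
rewrite [LHS]monalgE; apply: eq_bigr => g _.
by apply/malgP=> h; rewrite mcoeffZ !mcoeffU mulr_natr.
Qed.

Lemma aug_idealT x : aug_ideal R [set: G] x <-> aug x = 0.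
Proof. by split=> [[]|]. Qed.

Lemma ideal_aug_ideal : ideal (aug_ideal R [set: G]).
Proof.
split=> [|x y|a x]; rewrite !aug_idealT ?raddf0 //.
  by move=> x0 y0; rewrite raddfD /= x0 y0 addr0.
by move=> x0; rewrite rmorphM /= x0 mulr0.
Qed.

Lemma Phi_sub_aug N : Phi R N `<=` aug_ideal R [set: G].
Proof. by apply: smallest_sub ideal_aug_ideal _ => x [_ x0]; split. Qed.

Lemma PhiT : Phi R [set: G] = aug_ideal R [set: G].
Proof. exact/smallest_id/ideal_aug_ideal. Qed.

(** Translation by k permutes the elements of G and preserves the weights, so it
    preserves the weighted sum of coefficients. *)
Lemma mmap_mul_gr_of (w : G -> R) k y :
  (forall h, w (h * k)%g = w h) ->
  mmap idfun w (y * gr_of R k) = mmap idfun w y.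
Proof.
move=> wk; rewrite {1}/GRing.mul /= gr_mulgU raddf_sum /=.
by rewrite mmapE; apply: eq_bigr => h _; rewrite mmapU /= mulr1 wk.
Qed.

(** A congruence g = 1 modulo the ideal generated by k - 1 holds only when g is
    in the cyclic subgroup <k>; the conclusion states this membership with
    natural exponents.  The sum of the coefficients on <k> kills every multiple
    of k - 1, but equals -1 on g - 1 when g is outside <k>. *)
Lemma subr1_multiple g k y : gr_of R g - 1 = y * (gr_of R k - 1) ->
  exists i j, (g * k ^+ i = k ^+ j)%g.
Proof.
move=> e; apply: contrapT => nN.
pose N h := exists i j, (h * k ^+ i = k ^+ j)%g.
have NM h : N (h * k)%g = N h.
  apply/propext; split=> -[i [j e']].
    by exists i.+1, j; rewrite monoid.expgS monoid.mulgA.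
  by exists i, j.+1; rewrite -monoid.mulgA (mulgC k) monoid.mulgA e' monoid.expgSr.
pose w h : R := (asbool (N h))%:R.
have := congr1 (mmap idfun w) e; rewrite mulrBr mulr1.
rewrite [RHS]raddfB /= mmap_mul_gr_of ?subrr; last by move=> h; rewrite /w NM.
rewrite raddfB /= !mmapU /= !mul1r /w asboolF // asboolT; last first.
  by exists 0%N, 0%N; rewrite monoid.mulg1.
by move/eqP; rewrite sub0r oppr_eq0 oner_eq0.
Qed.

End GroupRing.

(** * Group rings in which augmentation detects units *)

(** Equivalently: RG is a local ring with maximal ideal I(R,G). *)
Definition aug_detects_units (R : comNzRingType) (G : abelianGroupType) :=
  forall x : group_ring R G, aug x != 0 -> exists y, y * x = 1.

(** A maximal ideal containing x is some Phi(N), which lies in the kernel of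
    the augmentation. *)
Lemma maximal_Phi_unit_aug (R : comNzRingType) (G : abelianGroupType) :
  (forall M, maximal_ideal M -> (Phi R @` subgroups G) M) ->
  aug_detects_units R G.
Proof.
move=> maxPhi x x0; apply: contrapT => nux.
have [|M Mmax Mx] := @exists_maximal_ideal _ x.
  by move=> y e; apply: nux; exists y.
have [N _ e] := maxPhi _ Mmax.
by move: Mx; rewrite -e => /Phi_sub_aug/aug_idealT/eqP; apply/negP.
Qed.

Section AugDetectsUnits.
Context (R : comNzRingType) (G : abelianGroupType).
Implicit Types (g : G).

Lemma unit_aug_field : aug_detects_units R G -> is_field R.
Proof.
move=> unit_aug a a0; have [|y e] := unit_aug (a *: 1).
  by rewrite aug_is_scalable rmorph1 mulr1.
exists (aug y); have := congr1 (@aug R G) e.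
by rewrite rmorphM /= aug_is_scalable rmorph1 mulr1.
Qed.

(** With s = 1 + g + ... + g^(n-1) invertible, say y s = 1, one gets
    g - 1 = y (g - 1) s = y (g^n - 1). *)
Lemma unit_aug_generator g n :
  aug_detects_units R G -> n%:R != 0 :> R ->
  exists i j, (g * (g ^+ n) ^+ i = (g ^+ n) ^+ j)%g.
Proof.
move=> unit_aug n0; pose s := \sum_(i < n) gr_of R g ^+ i.
have [|y e] := unit_aug s.
  rewrite raddf_sum (eq_bigr (fun=> 1)) ?sumr_const ?card_ord //= => i _.
  by rewrite rmorphXn /= aug_of expr1n.
apply: (@subr1_multiple R G g _ y).
by rewrite gr_ofX subrX1 mulrCA e mulr1.
Qed.

(** From g in <g^n> one reads off a relation between two powers of g, whose
    exponents differ modulo n as soon as n > 1. *)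
Lemma unit_aug_torsion g :
  aug_detects_units R G -> exists2 m, (0 < m)%N & (g ^+ m = 1)%g.
Proof.
move=> unit_aug.
have [n n2 n0] : exists2 n, (1 < n)%N & n%:R != 0 :> R.
  have [e2|] := eqVneq (2%:R : R) 0; last by exists 2%N.
  by exists 3%N => //; rewrite -[3%N]/(2 + 1)%N natrD e2 add0r oner_neq0.
have [i [j]] := unit_aug_generator g n unit_aug n0.
rewrite -!monoid.expgnA -monoid.expgS => e.
have ne : (n * i).+1 != n * j.
  apply/eqP => eq1; have := congr1 (modn^~ n) eq1.
  by rewrite modnMr -addn1 mulnC modnMDl modn_small.
have [lt|gt|eq1] := ltngtP (n * i).+1 (n * j); last by rewrite eq1 eqxx in ne.
  exists (n * j - (n * i).+1)%N; first by rewrite subn_gt0.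
  by rewrite monoid.expgnFr ?e ?monoid.mulgV // ltnW.
exists ((n * i).+1 - n * j)%N; first by rewrite subn_gt0.
by rewrite monoid.expgnFr ?e ?monoid.mulgV // ltnW.
Qed.

Lemma unit_aug_torsion_trivial g m :
  aug_detects_units R G -> m%:R != 0 :> R -> (g ^+ m = 1)%g -> g = 1%g.
Proof.
move=> unit_aug m0 gm; have [i [j]] := unit_aug_generator g m unit_aug m0.
by rewrite gm !monoid.expg1n monoid.mulg1.
Qed.

End AugDetectsUnits.

(** * Torsion and characteristic *)

Lemma has_order_pfactor (G : groupType) (g : G) p a :
  prime p -> (g ^+ (p ^ a) = 1)%g -> exists n, has_order g (p ^ n)%N.
Proof.
move=> p_pr ga.
have ex : exists m, (0 < m)%N && (g ^+ m == 1)%g.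
  by exists (p ^ a)%N; rewrite expn_gt0 prime_gt0 // ga eqxx.
have [m /andP[m0 /eqP gm] mmin] := ex_minnP ex.
have m_dvd : (m %| p ^ a)%N.
  rewrite /dvdn -leqn0 leqNgt; apply/negP => r0.
  have gr : (g ^+ (p ^ a %% m) = 1)%g.
    rewrite -[RHS]ga [in RHS](divn_eq (p ^ a) m) monoid.expgnDr mulnC.
    by rewrite monoid.expgnA gm monoid.expg1n monoid.mul1g.
  by have := mmin (p ^ a %% m)%N; rewrite r0 gr eqxx leqNgt ltn_pmod // => /(_ isT).
have [n _ e] := dvdn_pfactor m a p_pr m_dvd.
exists n; rewrite -e; split=> // k /andP[k0 km] gk.
by have := mmin k; rewrite k0 gk eqxx leqNgt km => /(_ isT).
Qed.

(** Induction on m: if the least prime factor of m is nonzero in R, it is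
    invertible there and can be cancelled from m. *)
Lemma field_natr0_pchar (R : comNzRingType) m :
  is_field R -> (0 < m)%N -> m%:R = 0 :> R -> exists p, p \in [pchar R].
Proof.
move=> Rf; elim/ltn_ind: m => m IHm m0 mR.
have m1 : (1 < m)%N.
  by rewrite ltn_neqAle m0 andbT; apply: contra_eq_neq mR => <-; apply: oner_neq0.
have p_pr := pdiv_prime m1.
have [pR|/Rf[c e]] := eqVneq ((pdiv m)%:R : R) 0.
  by exists (pdiv m); rewrite inE p_pr pR eqxx.
apply: (IHm (m %/ pdiv m)%N).
- by rewrite ltn_Pdiv // prime_gt1.
- by rewrite divn_gt0 ?pdiv_gt0 // pdiv_leq.
- rewrite -[LHS]mul1r -[X in X * _]e -mulrA -natrM mulnC divnK ?pdiv_dvd //.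
  by rewrite mR mulr0.
Qed.

Lemma unit_aug_p_group (R : comNzRingType) (G : abelianGroupType) p :
  aug_detects_units R G -> p \in [pchar R] -> p_group p G.
Proof.
move=> unit_aug pR g; have p_pr := pcharf_prime pR.
have [n n0 gn] := unit_aug_torsion R G g unit_aug.
have [m pm e] := pfactor_coprime p_pr n0.
apply: (@has_order_pfactor _ g p (logn p n)) => //.
apply: (unit_aug_torsion_trivial R G _ m unit_aug).
  by rewrite -(dvdn_pcharf pR) -prime_coprime.
by rewrite -monoid.expgnA mulnC -e.
Qed.

(** * Prime ideals of the group ring of a p-group in characteristic p *)

(** Each g - 1 is nilpotent, hence in P, so every x is congruent to its
    augmentation modulo P; as P is proper and nonzero constants are units, x is
    in P exactly when its augmentation is 0. *)
Lemma prime_ideal_p_group (R : comNzRingType) (G : abelianGroupType) p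
    (P : set (group_ring R G)) :
  is_field R -> p \in [pchar R] -> p_group p G -> prime_ideal P ->
  P = aug_ideal R [set: G].
Proof.
move=> Rf pR pG Ppr; have [/idealr_closedP[P0 P1 PL] _] := Ppr.
have pRG : p \in [pchar (group_ring R G)].
  by rewrite inE (pcharf_prime pR) -scaler_nat (pcharf0 pR) scale0r eqxx.
have P_of g : P (gr_of R g - 1).
  have [n [_ gn _]] := pG g.
  apply: (@prime_ideal_exp _ _ _ (p ^ n)%N Ppr).
  have p_nat : [pchar (group_ring R G)].-nat (p ^ n)%N.
    by rewrite pnatX pnatE ?(pcharf_prime pR) ?pRG.
  by rewrite exprDn_pchar // exprNn_pchar // -gr_ofX gn expr1n subrr.
have PB x : P (x - aug x *: 1).
  rewrite [x in x - _]gr_sumE /aug scaler_suml -sumrB.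
  elim/big_ind: _ => // [y z Py Pz|g _].
    by rewrite -[y]mul1r; apply: PL.
  rewrite -scalerBr -[_ - _]mul1r scalerAl -[_ * _]addr0.
  exact: PL.
apply/seteqP; split=> x.
  move=> Px; apply/aug_idealT; apply: contrapT => /eqP /Rf[c e].
  have := PL (-1) _ _ (PB x) Px; rewrite mulN1r opprB subrK => Paug.
  apply: P1; have := PL (c *: 1) _ _ Paug P0.
  by rewrite addr0 -scalerAl mul1r scalerA e scale1r.
by move/aug_idealT => x0; have := PB x; rewrite x0 scale0r subr0.
Qed.

Lemma prime_aug_ideal (R : comNzRingType) (G : abelianGroupType) :
  is_field R -> prime_ideal (aug_ideal R [set: G]).
Proof.
move=> Rf; have [I0 ID IM] := ideal_aug_ideal R G.
split.
  apply/idealr_closedP; split=> //.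
    by move/aug_idealT/eqP; rewrite rmorph1 oner_eq0.
  by move=> a u v Iu Iv; apply: ID => //; apply: IM.
move=> x y /set_mem/aug_idealT; rewrite rmorphM /= => xy0.
have [x0|/Rf[c e]] := eqVneq (aug x) 0.
  by apply/orP; left; apply/mem_set/aug_idealT.
apply/orP; right; apply/mem_set/aug_idealT.
by rewrite -[aug y]mul1r -e -mulrA xy0 mulr0.
Qed.

(** * The equivalence *)

Theorem corollary3p3 (R : comNzRingType) (G : abelianGroupType)
    (hRG : ~ [/\ is_field R, [pchar R] =i pred0 & forall g : G, g = 1%g]) :
  [<-> (* (1) *)
       forall M : set (group_ring R G),
         maximal_ideal M -> (Phi R @` subgroups G) M;
       (* (2) *)
       is_field R /\ exists p : nat, p \in [pchar R] /\ p_group p G;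
       (* (3) *)
       prime_ideal (aug_ideal R [set: G]) /\
         (forall P : set (group_ring R G),
            prime_ideal P -> P = aug_ideal R [set: G]);
       (* (4) *)
       forall P : set (group_ring R G),
         prime_ideal P -> (Phi R @` subgroups G) P].
Proof.
tfae.
- move=> /maximal_Phi_unit_aug unit_aug.
  have Rf := unit_aug_field R G unit_aug.
  split=> //; have [[p pR]|nchar] := pselect (exists p, p \in [pchar R]).
    by exists p; split=> //; apply: unit_aug_p_group unit_aug pR.
  have pchar0 p : p \in [pchar R] = false.
    by apply/negP => pR; apply: nchar; exists p.
  case: hRG; split=> // g.
  have [m m0 gm] := unit_aug_torsion R G g unit_aug.
  apply: (unit_aug_torsion_trivial R G _ m unit_aug) => //.
  apply/eqP => mR; have [p pR] := field_natr0_pchar R m Rf m0 mR.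
  by rewrite pchar0 in pR.
- move=> [Rf [p [pR pG]]]; split; first exact: prime_aug_ideal.
  by move=> P; apply: prime_ideal_p_group pR pG.
- move=> [_ uniq_prime] P /uniq_prime ->; exists [set: G]; last exact: PhiT.
  split=> [|g h _ _]; exact: in_setT.
- by move=> primePhi M /maximal_ideal_prime; apply: primePhi.
Qed.
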